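(* Let $X$ be a compact Hausdorff space that is hereditarily collectionwise Hausdorff. Then $dis(X) \geq \Delta(X)$.
   Context: All spaces are Hausdorff. $dis(X)$ denotes the least number of discrete sets required to cover $X$ (a subset of $X$ is discrete if its subspace topology is discrete; it need not be closed in $X$). $\Delta(X)$ denotes the least cardinality of a nonempty open subset of $X$ (for nonempty $X$). A space $Y$ is collectionwise Hausdorff if for every closed discrete subset $D \subset Y$ there is a family $\{U_d : d \in D\}$ of pairwise disjoint open sets of $Y$ with $d \in U_d$ for every $d\in D$; $X$ is hereditarily collectionwise Hausdorff if every subspace of $X$ is collectionwise Hausdorff. *)

(* Defs.v *)
From mathcomp Require Import all_boot.
From mathcomp Require Import boolp classical_sets functions cardinality.
From mathcomp Require Import topology.

Set Implicit Arguments.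
Unset Strict Implicit.
Unset Printing Implicit Defensive.

Local Open Scope classical_set_scope.
Local Open Scope card_scope.

(* Cardinal numbers are represented by sets and compared with [#<=]: the least
   cardinality of a member of [C] is represented by a chosen member of [C]
   that injects into every other one ([ex_least_card]: there is one as soon as
   [C] is nonempty). *)
Definition least_card (T : Type) (C : set (set T)) : set T :=
  get [set A | C A /\ forall B, C B -> A #<= B].

Lemma ex_least_card (T : Type) (C : set (set T)) : C !=set0 ->
  exists A, C A /\ forall B, C B -> A #<= B.
Proof.
move=> [A0 CA0]; pose I := {A : set T | C A}.
pose P := [set S : set (I -> T) | (forall s i, S s -> sval i (s i)) /\
  (forall s t i, S s -> S t -> s i = t i -> s = t)].
have /Zorn_bigcup[S [[SA Sinj] Smax]] : forall F : set (set (I -> T)),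
    F `<=` P -> total_on F subset -> P (\bigcup_(X in F) X).
  move=> F FP Ftot; split=> [s i [X /FP[XA _] /XA]//|s t i [X FX Xs] [Y FY Yt]].
  have [XY|YX] := Ftot _ _ FX FY.
    by case: (FP _ FY) => _ Yinj; apply: Yinj => //; exact: XY.
  by case: (FP _ FX) => _ Xinj; apply: Xinj => //; exact: YX.
have [i iS] : exists i : I, sval i `<=` (fun s => s i) @` S.
  apply: contrapT => /forallNP nS.
  have /choice[f fP] : forall i : I,
      exists x, sval i x /\ ~ ((fun s => s i) @` S) x.
    by move=> i; have /existsNP[x /not_implyP] := nS i; exists x.
  apply: (Smax (S `|` [set f])); first split.
  - by move=> s Ss; left.
  - move=> /(_ f (or_intror erefl)) Sf.
    by apply: (fP (exist _ A0 CA0)).2; exists f.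
  - split=> [s i [/SA//|->]|s t i [Ss|->] [St|->]//].
    + exact: (fP i).1.
    + exact: Sinj.
    + by move=> sfi; case: (fP i).2; exists s.
    + by move=> fti; case: (fP i).2; exists t.
exists (sval i); split=> [|B CB]; first exact: svalP.
pose j : I := exist _ B CB.
apply: card_le_trans (subset_card_le iS) _.
apply: card_le_trans (card_image_le _ _) _.
have /inj_card_eq : {in S &, injective (fun s : I -> T => s j)}.
  by move=> s t /set_mem Ss /set_mem St; exact: Sinj.
rewrite card_eq_le => /andP[_ SjS]; apply: card_le_trans SjS _.
by apply: subset_card_le => _ [s Ss <-]; exact: (SA s j).
Qed.

Lemma least_cardP (T : Type) (C : set (set T)) : C !=set0 ->
  C (least_card C) /\ forall B, C B -> least_card C #<= B.
Proof. by move=> /ex_least_card; exact: getPex. Qed.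

Definition discrete_space (T : topologicalType) := forall U : set T, open U.

(* [set_type A] carries the subspace topology. *)
Definition discrete_set (X : topologicalType) (A : set X) :=
  discrete_space (set_type A).

Definition discrete_cover (X : topologicalType) (F : set (set X)) :=
  (forall A, F A -> discrete_set A) /\ \bigcup_(A in F) A = setT.

Definition dis (X : topologicalType) : set (set X) :=
  least_card (@discrete_cover X).
Arguments dis : clear implicits.

Definition Delta (X : topologicalType) : set X :=
  least_card [set U : set X | open U /\ U !=set0].
Arguments Delta : clear implicits.

Lemma disP (X : topologicalType) :
  discrete_cover (dis X) /\
  forall F : set (set X), discrete_cover F -> dis X #<= F.
Proof.
apply: least_cardP; exists (range (@set1 X)); split; last first.
  by rewrite -subTset => x _; exists [set x] => //; exists x.
move=> _ [x _ <-] U; have [[u Uu]|] := pselect (U !=set0).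
  suff -> : U = setT by exact: openT.
  rewrite -subTset => v _; suff -> : v = u by [].
  apply: val_inj.
  by have /set_mem -> := valP v; have /set_mem -> := valP u.
by move=> /set0P/negP/negPn/eqP->; exact: open0.
Qed.

Lemma DeltaP (X : topologicalType) : [set: X] !=set0 ->
  (open (Delta X) /\ Delta X !=set0) /\
  forall U : set X, open U -> U !=set0 -> Delta X #<= U.
Proof.
move=> X0; have [|DX DXle] :=
    @least_cardP X [set U : set X | open U /\ U !=set0].
  by exists setT; split => //; exact: openT.
by split=> // U oU U0; exact: DXle.
Qed.

Definition collectionwise_hausdorff (Y : topologicalType) :=
  forall D : set Y, closed D -> discrete_set D ->
  exists U : Y -> set Y,
    (forall d, D d -> open (U d) /\ U d d) /\ trivIset D U.

Definition hereditarily_collectionwise_hausdorff (X : topologicalType) :=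
  forall A : set X, collectionwise_hausdorff (set_type A).

(* Main.v *)
From HB Require Import structures.
Require Import Defs.
From mathcomp Require Import all_boot.
From mathcomp Require Import boolp classical_sets functions cardinality.
From mathcomp Require Import topology finmap.

(** Let [F] be a cover of [X] by [dis X] discrete sets. The goal is a nonempty
open set [V] with [V #<= F].

If [F] is finite, then [X] has an isolated point
([finite_discrete_cover_isolated]) and [V] can be a singleton.

If [F] is infinite, then [F `*` F #<= F] ([card_setX_infinite]), so it suffices
to find [V] such that each discrete subset of [V] has cardinality at most that
of [F]: [V] is the union of its traces on the members of [F]. This bound
follows once [V] has a dense subset [P] with [P #<= F], because a discrete set
[D] is closed and discrete in the open complement of its limit points;
hereditary collectionwise Hausdorffness therefore expands [D] to disjoint open
sets ([discrete_expansion]), and [P] meets each of them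
([card_discrete_le_dense]).

It remains to find [V] and [P]. By Zorn's lemma, each nonempty compact set [K]
carries a pattern made of a member [A] of [F] and a finite list [s] of members
of [F]: some point of [A] lies in [K] and is a limit point of every member of
[s], while no point of [K] is at once a limit point of [A] and of all members
of [s] ([compact_has_pattern]). The second half is an open condition on [K],
hence it still holds for the closure of a small enough neighborhood [V] of [K];
and when it holds for [closure V], compactness leaves only finitely many points
of [A] in [closure V] that are limit points of every member of [s]. Let
[trap F V] collect these points over all patterns that fit [closure V]: it is a
union of at most as many finite sets as there are patterns, so
[trap F V #<= F] ([card_trap_le]). If no trap were dense in its [V], one could
build a sequence of nonempty open sets, each with its closure inside the
previous one and disjoint from the previous trap. The intersection [K] of the
closures is compact and nonempty, so it has a pattern; this pattern already
fits the closure of some set of the sequence, whose trap then contains a point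
of [K], a contradiction ([exists_dense_trap]). *)

Set Implicit Arguments.
Unset Strict Implicit.
Unset Printing Implicit Defensive.

Local Open Scope classical_set_scope.
Local Open Scope card_scope.

(** * Infinite cardinals absorb products, unions and finite sequences *)

Lemma pcard_le_injP (T : Type) (U : pointedType) (A : set T) (B : set U) :
  A #<= B <-> exists2 f : T -> U, set_fun A B f & set_inj A f.
Proof.
split=> [/pcard_leP/injfunPex//|/injfunPex AB]; exact/pcard_leP.
Qed.

(** Cardinals are comparable: a least element of a family of two sets injects
into the other one. *)
Lemma card_le_or (T : Type) (A B : set T) : A #<= B \/ B #<= A.
Proof.
have [|C [[->|->] CP]] := @ex_least_card T [set A; B].
- by exists A; left.
- by left; apply: CP; right.
- by right; apply: CP; left.
Qed.

Lemma card_le_setX (T T' : Type) (U U' : pointedType) (A : set T) (A' : set T')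
    (B : set U) (B' : set U') :
  A #<= B -> A' #<= B' -> A `*` A' #<= B `*` B'.
Proof.
move=> /pcard_le_injP[f fB finj] /pcard_le_injP[g gB ginj].
apply/pcard_le_injP; exists (fun z => (f z.1, g z.2)).
  by move=> [x y] [/= Ax Ay]; split; [exact: fB|exact: gB].
move=> [x y] [x' y'] /set_mem[/= Ax Ay] /set_mem[/= Ax' Ay'] [fx gy].
by congr pair; [apply: finj|apply: ginj] => //; exact/mem_set.
Qed.

(** Injections of [A] and of [B] into [D], tagged with two distinct points of
[D], inject the union into [D `*` D]. *)
Lemma card_le_setU (T : Type) (U : pointedType) (A B : set T) (D : set U) :
  infinite_set D -> D `*` D #<= D -> A #<= D -> B #<= D -> A `|` B #<= D.
Proof.
move=> Dinf DD /pcard_le_injP[f fD finj] /pcard_le_injP[g gD ginj].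
apply: card_le_trans DD; apply/pcard_le_injP.
have /infiniteP/pcard_le_injP[e eD einj] := Dinf.
exists (fun x => if x \in A then (e 0, f x) else (e 1, g x)).
  move=> x ABx /=; have [/set_mem Ax|/negP nAx] := boolP (x \in A).
    by split; [exact: eD|exact: fD].
  split; [exact: eD|]; apply: gD; case: ABx => // Ax.
  by case: nAx; exact/mem_set.
have e01 : e 0 <> e 1.
  by move=> /einj e01; have // := e01 (mem_set I) (mem_set I).
move=> x y /set_mem ABx /set_mem ABy.
case: ifPn => xA; case: ifPn => yA [].
- exact: finj.
- by move=> ee; case: (e01 ee).
- by move=> ee; case: (e01 (esym ee)).
- apply: ginj; apply/mem_set.
  + by case: ABx => // /mem_set; rewrite (negbTE xA).
  + by case: ABy => // /mem_set; rewrite (negbTE yA).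
Qed.

(** Zorn's lemma gives a maximal infinite [B `<=` A] with an injection
[f : B `*` B -> B]. If [A `\` B] injects into [B], then so does [A]. Otherwise
[A `\` B] contains a copy [C] of [B]; the square of [B `|` C] still injects
into [C], so sending the pairs outside [B `*` B] to [C] extends [f] to
[B `|` C], against maximality. *)
Lemma card_setX_infinite (T : pointedType) (A : set T) :
  infinite_set A -> A `*` A #<= A.
Proof.
move=> Ainf.
pose squared (p : set T * (T * T -> T)) :=
  [/\ p.1 `<=` A, infinite_set p.1, set_fun (p.1 `*` p.1) p.1 p.2
    & set_inj (p.1 `*` p.1) p.2].
pose S := {p | squared p}.
pose R (s t : S) : bool := `[< (sval s).1 `<=` (sval t).1 /\
  {in (sval s).1 `*` (sval s).1, (sval s).2 =1 (sval t).2} >].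
(* A countably infinite subset of [A] starts the construction. *)
have [s0 _] : exists s : S, True.
  have /infiniteP/pcard_le_injP[e eA einj] := Ainf.
  have eN : range e #= [set: nat] by exact: inj_card_eq.
  have [|f fN finj] := (pcard_le_injP (range e `*` range e) (range e)).1.
    rewrite (card_le_eqr eN) -(card_le_eqr card_nat2) -setXTT.
    apply: card_le_setX; by rewrite (card_le_eql eN) card_lexx.
  suff eP : squared (range e, f) by exists (exist _ _ eP).
  split=> //=; first by move=> _ [n _ <-]; exact: eA.
  by apply/infiniteP; move: eN; rewrite card_eq_le => /andP[].
have [|||[[B f] BP] Bmax] := @ZL_preorder S s0 R.
- by move=> s; apply/asboolP; split=> [x|z].
- move=> r s t /asboolP[rs frs] /asboolP[st fst']; apply/asboolP.
  split=> [|z zr]; first exact: subset_trans st.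
  rewrite frs// fst'//; apply/mem_set.
  by have /set_mem[/= /rs ? /rs ?] := zr.
- move=> C Ctot; have [->|/set0P[c0 Cc0]] := eqVneq C set0; first by exists s0.
  pose B := \bigcup_(s in C) (sval s).1.
  have CB z : (B `*` B) z -> exists2 s, C s & ((sval s).1 `*` (sval s).1) z.
    move=> [[s Cs sz] [t Ct tz]].
    have [/asboolP[st _]|/asboolP[ts _]] := Ctot _ _ Cs Ct.
      by exists t => //; split => //; exact: st.
    by exists s => //; split => //; exact: ts.
  have /choice[f fP] : forall z, exists y, forall s, C s ->
      ((sval s).1 `*` (sval s).1) z -> (sval s).2 z = y.
    move=> z; have [[s [Cs sz]]|nz] :=
        pselect (exists s, C s /\ ((sval s).1 `*` (sval s).1) z); last first.
      by exists point => s Cs sz; case: nz; exists s.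
    exists ((sval s).2 z) => t Ct tz.
    have [/asboolP[_ ->]//|/asboolP[_ ->]//] := Ctot _ _ Cs Ct; exact/mem_set.
  have BP : squared (B, f).
    split=> /=.
    + by move=> x [s _]; case: (svalP s) => /(_ x).
    + apply: (@sub_infinite_set _ (sval c0).1); last by case: (svalP c0).
      by move=> x c0x; exists c0.
    + move=> z /CB[s Cs sz]; exists s => //; rewrite -(fP _ _ Cs sz).
      by case: (svalP s) => _ _ + _; apply.
    + move=> z w /set_mem Bz /set_mem Bw.
      have [s Cs sz] := CB _ Bz; have [t Ct tw] := CB _ Bw.
      have [u [Cu uz uw]] : exists u, [/\ C u,
          ((sval u).1 `*` (sval u).1) z & ((sval u).1 `*` (sval u).1) w].
        have [/asboolP[st _]|/asboolP[ts _]] := Ctot _ _ Cs Ct.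
          by exists t; split=> //; case: sz => /st ? /st.
        by exists s; split=> //; case: tw => /ts ? /ts.
      rewrite -(fP _ _ Cu uz) -(fP _ _ Cu uw).
      by case: (svalP u) => _ _ _; apply; exact/mem_set.
  exists (exist _ _ BP) => s Cs; apply/asboolP; split => /=.
    by move=> x sx; exists s.
  by move=> z /set_mem sz; exact: fP.
have {}Bmax (q : set T * (T * T -> T)) : squared q -> B `<=` q.1 ->
    {in B `*` B, f =1 q.2} -> q.1 `<=` B.
  move=> qP Bq fq; have /asboolP[] // : R (exist _ _ qP) (exist _ _ BP).
  by apply: Bmax; apply/asboolP.
have {BP}[/= BA Binf fB finj] := BP.
have BB : B `*` B #<= B by apply/pcard_le_injP; exists f.
have [CB|BC] := card_le_or (A `\` B) B.
  have AB : A #<= B.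
    rewrite -(setUIDK A B); apply: card_le_setU => //.
    by apply: subset_card_le; exact: subIsetr.
  by apply: card_le_trans (card_le_setX AB AB) _;
     apply: card_le_trans BB _; exact: subset_card_le.
have /pcard_le_injP[i iC iinj] := BC.
have Ci : i @` B #= B by exact: inj_card_eq.
pose B' := B `|` i @` B.
have B'B : B' #<= B.
  by apply: card_le_setU => //; rewrite ?card_lexx// (card_le_eql Ci) card_lexx.
have /pcard_le_injP[k kC kinj] : B' `*` B' #<= i @` B.
  rewrite (card_le_eqr Ci); apply: card_le_trans BB.
  exact: card_le_setX.
have iB x : (i @` B) x -> ~ B x by move=> [y /iC[_ nB] <-].
pose f' z := if z \in B `*` B then f z else k z.
have B'P : squared (B', f').
  split=> /=.
  - by move=> x [/BA//|[y /iC[? _] <-]].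
  - by apply: (sub_infinite_set _ Binf) => x Bx; left.
  - move=> z B'z; rewrite /f'; case: ifPn => [/set_mem zB|_].
      by left; exact: fB.
    by right; exact: kC.
  - move=> z w zB' wB'; rewrite /f'.
    case: ifPn => zB; case: ifPn => wB.
    + exact: finj.
    + move=> fk; exfalso; apply: (iB _ (kC _ (set_mem wB'))).
      by rewrite -fk; exact/fB/set_mem.
    + move=> kf; exfalso; apply: (iB _ (kC _ (set_mem zB'))).
      by rewrite kf; exact/fB/set_mem.
    + exact: kinj.
have B'sB : B' `<=` B.
  by apply: (Bmax _ B'P) => [x|z zB] /=; [left|rewrite /f' zB].
have [b Bb] := infinite_setN0 Binf.
have ib : (i @` B) (i b) by exists b.
by case: (iB _ ib); apply: B'sB; right.
Qed.

Lemma card_le_bigcup (I T : Type) (U : pointedType) (J : set I) (G : I -> set T)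
    (D : set U) :
  infinite_set D -> J #<= D -> (forall i, J i -> G i #<= D) ->
  \bigcup_(i in J) G i #<= D.
Proof.
move=> Dinf /pcard_le_injP[f fD finj] GD.
apply: card_le_trans (card_setX_infinite Dinf); apply/pcard_le_injP.
have /choice[g gP] : forall i, exists g : T -> U,
    J i -> set_fun (G i) D g /\ set_inj (G i) g.
  move=> i; have [Ji|nJi] := pselect (J i); last by exists (fun=> point).
  by have /pcard_le_injP[g gD ginj] := GD i Ji; exists g.
have [i0|nI] := pselect (exists i : I, True); last first.
  exists (fun=> point) => [x [i]|x y /set_mem[i]]; by case: nI; exists i.
have /choice[h hP] : forall x, exists i,
    (\bigcup_(i in J) G i) x -> J i /\ G i x.
  move=> x; have [[i Ji Gx]|nx] := pselect ((\bigcup_(i in J) G i) x).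
    by exists i.
  by have [i _] := i0; exists i => /nx.
exists (fun x => (f (h x), g (h x) x)).
  move=> x /hP[Jh Gh]; split; first exact: fD.
  by have [gD _] := gP _ Jh; exact: gD.
move=> x y /set_mem/hP[Jx Gx] /set_mem/hP[Jy Gy] [].
move=> /finj -/(_ (mem_set Jx) (mem_set Jy)) hxy.
have [_ ginj] := gP _ Jx; rewrite -hxy => gxy.
by apply: ginj gxy; apply/mem_set => //; rewrite hxy.
Qed.

Lemma finite_card_le (T U : Type) (A : set T) (D : set U) :
  infinite_set D -> finite_set A -> A #<= D.
Proof. by move=> /infiniteP Dinf /finite_set_countable/card_le_trans; apply. Qed.

(** The sequences of each fixed size are at most [A] many, by induction on the
size, and there are countably many sizes. *)
Lemma card_le_seqs (T : pointedType) (A : set T) : infinite_set A ->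
  [set s : seq T | [set` s] `<=` A] #<= A.
Proof.
move=> Ainf.
pose G n := [set s : seq T | size s = n /\ [set` s] `<=` A].
apply: (@card_le_trans _ _ _ (\bigcup_n G n)).
  by apply: subset_card_le => s sA; exists (size s).
apply: card_le_bigcup => //; first exact/infiniteP.
move=> n _; elim: n => [|n IHn].
  apply: finite_card_le => //; apply: (@sub_finite_set _ _ [set [::]]) => //.
  by move=> s [/size0nil->].
apply: card_le_trans (card_setX_infinite Ainf).
apply: card_le_trans (card_le_setX (card_lexx A) IHn).
apply: card_le_trans (card_image_le (fun z => z.1 :: z.2) _).
apply: subset_card_le => -[[]//|a s] [/= [sn] sA].
exists (a, s) => //; split=> /=; first by apply: sA; rewrite /= mem_head.
by split=> // x /= xs; apply: sA; rewrite /= inE xs orbT.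
Qed.

(** * Compactness, limit points and discrete sets *)

(** The empty set is trivially covered, and otherwise a point of [K] makes the
space pointed, which is the setting of [compact_cover]. *)
Lemma compact_cover_compact (X : topologicalType) (K : set X) :
  compact K -> cover_compact K.
Proof.
move=> cK; have [K0|/set0P[x _]] := eqVneq K set0.
  by move=> I D f _ _; exists fset0 => // y; rewrite K0.
pose pX : ptopologicalType := HB.pack X (isPointed.Build X x).
have : @compact pX K by [].
by rewrite compact_cover.
Qed.

Lemma compact_bigcap_directed (X : topologicalType) (I : Type) (D : set I)
    (G : I -> set X) : compact [set: X] -> D !=set0 ->
  (forall i, D i -> closed (G i) /\ G i !=set0) ->
  (forall i j, D i -> D j -> exists2 k, D k & G k `<=` G i `&` G j) ->
  \bigcap_(i in D) G i !=set0.
Proof.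
move=> cX [i0 Di0] GP Gdir.
have FG : ProperFilter (filter_from D G).
  apply: filter_from_proper; last by move=> i /GP[].
  by apply: filter_from_filter => //; exists i0.
have [x [_ xG]] := cX _ FG (filterT).
exists x => i Di; have [clG _] := GP i Di; apply: clG => U Ux.
by apply: xG => //; exists i.
Qed.

Lemma compact_nested_sub (X : topologicalType) (C : nat -> set X) (W : set X) :
  compact [set: X] -> (forall n, closed (C n)) -> (forall n, C n.+1 `<=` C n) ->
  open W -> \bigcap_n C n `<=` W -> exists n, C n `<=` W.
Proof.
move=> cX clC Cdec oW CW; apply: contrapT => /forallNP nCW.
have Cle m n : m <= n -> C n `<=` C m.
  elim: n => [|n IHn]; first by rewrite leqn0 => /eqP->.
  rewrite leq_eqVlt => /predU1P[->//|/IHn]; exact: subset_trans.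
have [|||x xC] := @compact_bigcap_directed _ _ [set: nat] (fun n => C n `\` W) cX.
- by exists 0.
- move=> n _; split; first by apply: closedI => //; exact: open_closedC.
  by apply/set0P/negP => /eqP; rewrite setD_eq0; exact: nCW.
- move=> m n _ _; exists (maxn m n) => // x [Cx nWx].
  by split; split => //; apply: Cle Cx; rewrite ?leq_maxl ?leq_maxr.
have [_] := xC 0 I; apply; apply: CW => n _; by have [] := xC n I.
Qed.

(** The open set of non-limit points of a discrete set [A] therefore contains
[A], and every point of that open set has a neighborhood meeting [A] in at most
that point; this is used throughout in place of the subspace topology. *)
Lemma discrete_setP (X : topologicalType) (A : set X) :
  discrete_set A <-> A `<=` ~` limit_point A.
Proof.
split=> [dA x Ax|dA U].
  have [W oW Wx] := dA [set SigSub (mem_set Ax)].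
  rewrite /setC /= not_limit_pointE; exists W.
    apply: open_nbhs_nbhs; split => //.
    have : (val @^-1` W) (SigSub (mem_set Ax) : set_type A) by rewrite Wx.
    by [].
  move=> y [Ay Wy]; have : (val @^-1` W) (SigSub (mem_set Ay) : set_type A) by [].
  by rewrite Wx => /(congr1 val).
rewrite openE => u Uu; have := dA _ (set_mem (valP u)).
rewrite /setC /= not_limit_pointE => -[V]; rewrite nbhsE => -[W [oW Wu] WV] VA.
rewrite /interior nbhsE; exists (val @^-1` W); first by split=> //; exists W.
move=> v Wv; suff -> : v = u by [].
by apply: val_inj; apply: VA; split; [exact/set_mem/valP|exact: WV].
Qed.

Lemma discrete_setS (X : topologicalType) (A B : set X) :
  A `<=` B -> discrete_set B -> discrete_set A.
Proof.
move=> AB /discrete_setP dB; apply/discrete_setP => x /[dup] Ax /AB/dB.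
apply: contra_not => lAx U /lAx[y [yx Ay Uy]].
by exists y; split=> //; exact: AB.
Qed.

Lemma open_limit_pointC (X : topologicalType) (A : set X) : hausdorff_space X ->
  open (~` limit_point A).
Proof.
by move=> hX; apply/closed_openC/limit_point_closed/hausdorff_accessible.
Qed.

(** [A] need not be closed in [X], but it is closed and discrete in the
complement [Y] of its limit points. As [Y] is open, a disjoint expansion of [A]
in [Y] consists of open sets of [X]. *)
Lemma discrete_expansion (X : topologicalType) (A : set X) : hausdorff_space X ->
  hereditarily_collectionwise_hausdorff X -> discrete_set A ->
  exists W : X -> set X,
    (forall a, A a -> open (W a) /\ W a a) /\ trivIset A W.
Proof.
move=> hX hcwh /discrete_setP dA; pose Y := ~` limit_point A.
have oY : open Y by exact: open_limit_pointC.
pose D : set (set_type Y) := val @^-1` A.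
have isoY (y : set_type Y) : exists2 V : set X, open V /\ V (val y) &
    A `&` V `<=` [set val y].
  have := set_mem (valP y); rewrite /Y /setC /= not_limit_pointE => -[V].
  rewrite nbhsE => -[W Wy WV] VA; exists W => //.
  by apply: subset_trans VA; exact: setIS.
have isoD (y : set_type Y) : ~ limit_point D y.
  rewrite not_limit_pointE; have [V [oV Vy] VA] := isoY y.
  exists (val @^-1` V); first by apply: open_nbhs_nbhs; split=> //; exists V.
  by move=> z [Dz Vz]; apply: val_inj; exact: VA.
have clD : closed D.
  rewrite -[D]setCK; apply: open_closedC; rewrite openE => y nDy.
  have [V [oV Vy] VA] := isoY y.
  rewrite /interior nbhsE; exists (val @^-1` V); first by split=> //; exists V.
  by move=> z Vz Dz; apply: nDy; rewrite /D /=; have <- : val z = val y by exact: VA.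
have [|U [UP Utriv]] := hcwh Y D clD; first by apply/discrete_setP => y _; exact: isoD.
have oval (B : set (set_type Y)) : open B -> open (val @` B).
  move=> [V oV <-]; suff -> : val @` (val @^-1` V : set (set_type Y)) = V `&` Y.
    exact: openI.
  apply/seteqP; split=> [_ [z Vz <-]|x [Vx Yx]].
    by split=> //; exact/set_mem/valP.
  by exists (SigSub (mem_set Yx)).
exists (fun a => [set x | exists2 y : set_type Y, val y = a & (val @` U y) x]).
have WE (y : set_type Y) :
    [set x | exists2 z : set_type Y, val z = val y & (val @` U z) x] = val @` U y.
  by apply/seteqP; split=> [x [z /val_inj->]//|x Ux]; exists y.
split=> [a Aa|a b Aa Ab [x [[y ya [u Uu ux]] [z zb [v Uv vx]]]]].
  have [oUa Uaa] := UP (SigSub (mem_set (dA a Aa))) Aa.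
  rewrite (WE (SigSub (mem_set (dA a Aa)))); split; first exact: oval.
  by exists (SigSub (mem_set (dA a Aa))).
rewrite -ya -zb; congr val; apply: Utriv; rewrite /D /= ?ya ?zb //.
exists u; split=> //; suff -> : u = v by [].
by apply: val_inj; rewrite ux vx.
Qed.

(** If [U] meets [A] in a point [a] isolated in [A], then a neighborhood of [a]
minus [a] is covered by the other members of [s], unless it is empty, in which
case [a] is isolated in [X]. *)
Lemma finite_discrete_cover_isolated (X : topologicalType) (s : seq (set X))
    (U : set X) : hausdorff_space X -> (forall A, A \in s -> discrete_set A) ->
  open U -> U !=set0 -> U `<=` \bigcup_(A in [set` s]) A ->
  exists x : X, open [set x].
Proof.
move=> hX; elim: s U => [|A s IHs] U sd oU [x Ux] Us.
  by have [] := Us x Ux.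
have [[a [Ua Aa]]|nUA] := pselect (U `&` A !=set0); last first.
  apply: (IHs U) => //; first by move=> B Bs; apply: sd; rewrite inE Bs orbT.
    by exists x.
  move=> y Uy; have [B] := Us y Uy; rewrite /= inE => /predU1P[->|Bs] By.
    by case: nUA; exists y.
  by exists B.
have /discrete_setP/(_ a Aa) := sd A (mem_head _ _).
rewrite /setC /= not_limit_pointE => -[V]; rewrite nbhsE => -[W [oW Wa] WV] VA.
have oUW : open ((U `&` W) `\ a).
  apply: openI; first exact: openI.
  exact/closed_openC/accessible_closed_set1/hausdorff_accessible.
have [UW0|/set0P UW0] := eqVneq ((U `&` W) `\ a) set0.
  exists a; suff -> : [set a] = U `&` W by exact: openI.
  apply/seteqP; split=> [_ ->//|y UWy]; apply: contrapT => ya.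
  suff : set0 y by []; by rewrite -UW0.
apply: (IHs _ _ oUW UW0); first by move=> B Bs; apply: sd; rewrite inE Bs orbT.
move=> y [[Uy Wy] ya]; have [B] := Us y Uy; rewrite /= inE => /predU1P[->|Bs] By.
  by case: ya; apply: VA; split=> //; exact: WV.
by exists B.
Qed.

(** Each point of [K] has a neighborhood containing at most one point of [A],
and finitely many of these neighborhoods cover [K]. *)
Lemma compact_finite_discrete (X : topologicalType) (K A : set X) : compact K ->
  K `<=` ~` limit_point A -> finite_set (K `&` A).
Proof.
move=> /compact_cover_compact cK KA.
have /choice[W WP] : forall x, exists W : set X,
    K x -> [/\ open W, W x & A `&` W `<=` [set x]].
  move=> x; have [/KA|nKx] := pselect (K x); last by exists set0.
  rewrite /setC /= not_limit_pointE => -[V]; rewrite nbhsE => -[W [oW Wx] WV] VA.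
  by exists W => _; split=> //; apply: subset_trans VA; exact: setIS.
have [||D DK KD] := cK X K W; first by move=> x /WP[].
  by move=> x Kx; exists x => //; have [] := WP x Kx.
apply: (@sub_finite_set _ _ [set` D]); last exact: finite_fset.
move=> x [Kx Ax]; have [y /= yD Wyx] := KD x Kx.
have [_ _ /(_ x) ->] := WP y (set_mem (DK y yD)); by [].
Qed.

(** * Patterns of limit points and the dense trap *)

Definition common_limit_points (X : topologicalType) (S : set (set X)) : set X :=
  \bigcap_(B in S) limit_point B.

Lemma closed_common_limit_points (X : topologicalType) (S : set (set X)) :
  hausdorff_space X -> closed (common_limit_points S).
Proof.
by move=> hX; apply: closed_bigI => B _; exact/limit_point_closed/hausdorff_accessible.
Qed.

(** Take [S `<=` F] maximal such that [K] contains a common limit point of the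
members of [S]; a directed union of such families is one again because [K] is
compact. Let [x] be such a point of [K] and [A] a member of [F] containing it.
Since [A] is discrete, [x] is not a limit point of [A], so [A] is not in [S].
By maximality no point of [K] is a limit point of [A] and of all members of
[S], and compactness of [K] reduces [S] to a finite list. *)
Lemma compact_has_pattern (X : topologicalType) (F : set (set X)) (K : set X) :
  compact [set: X] -> hausdorff_space X -> discrete_cover F ->
  closed K -> K !=set0 ->
  exists A (s : seq (set X)), [/\ F A, [set` s] `<=` F,
    K `<=` ~` (common_limit_points [set` s] `&` limit_point A)
    & exists x, [/\ K x, common_limit_points [set` s] x & A x]].
Proof.
move=> cX hX [Fd Fcov] clK K0.
pose meeting (S : set (set X)) := S `<=` F /\ K `&` common_limit_points S !=set0.
have [C Cm Ctot|S [[SF [x [Kx Sx]]] Smax]] := @Zorn_bigcup _ meeting.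
  split=> [A [S /Cm[SF _]]|]; first exact: SF.
  have [->|C0] := eqVneq C set0.
    have [x Kx] := K0; exists x; split=> // B; by rewrite bigcup_set0.
  have [||S T CS CT|x xC] := @compact_bigcap_directed _ _ C
      (fun S => K `&` common_limit_points S) cX.
  - exact/set0P.
  - move=> S CS; split; last by have [] := Cm S CS.
    by apply: closedI => //; exact: closed_common_limit_points.
  - have [ST|TS] := Ctot _ _ CS CT; [exists T|exists S] => // x [Kx lx].
      by split; split=> // B /ST; exact: lx.
    by split; split=> // B /TS; exact: lx.
  have /set0P[S0 CS0] := C0; exists x; split; first by case: (xC S0 CS0).
  by move=> B [S CS SB]; have [_] := xC S CS; exact.
have [A FA Ax] : (\bigcup_(A in F) A) x by rewrite Fcov.
have nAx : ~ limit_point A x by have /discrete_setP := Fd A FA; exact.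
have KA : K `<=` \bigcup_(B in S `|` [set A]) ~` limit_point B.
  rewrite -setC_bigcap -[X in ~` X]/(common_limit_points _).
  move=> y Ky ly; apply: (Smax (S `|` [set A])).
    split; first by left.
    by move=> SAS; apply: nAx; apply: Sx; apply: SAS; right.
  split; first by move=> B [/SF//|->].
  by exists y.
have cK : compact K by exact: subclosed_compact cX _.
have [|D DS KD] := compact_cover_compact cK _ KA.
  by move=> B _; exact: open_limit_pointC.
pose s := [seq B <- D | B != A].
have sS : [set` s] `<=` S.
  move=> B /=; rewrite mem_filter => /andP[/eqP BA /DS/set_mem[//|]].
  by move/BA.
exists A, s; split=> //; first by move=> B /sS/SF.
  move=> y Ky [sy Ay]; have [B /= BD] := KD y Ky; apply.
  have [->//|BA] := eqVneq B A.
  by apply: sy; rewrite /= mem_filter BA.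
by exists x; split=> // B /sS; exact: Sx.
Qed.

(** The points of [closure V] selected by the patterns that fit it. Only
finitely many come from each pattern, and a compact subset of [closure V] whose
own pattern fits [closure V] contains at least one of them. *)
Definition trap (X : topologicalType) (F : set (set X)) (V : set X) : set X :=
  \bigcup_(z in [set z : set X * seq (set X) | [/\ F z.1, [set` z.2] `<=` F &
      closure V `<=` ~` (common_limit_points [set` z.2] `&` limit_point z.1)]])
    (closure V `&` common_limit_points [set` z.2] `&` z.1).

(** There are at most [F] many patterns, and a pattern selects the points of a
discrete set in a compact set free of its limit points. *)
Lemma card_trap_le (X : topologicalType) (F : set (set X)) (V : set X) :
  compact [set: X] -> hausdorff_space X -> infinite_set F ->
  trap F V #<= F.
Proof.
move=> cX hX Finf; apply: card_le_bigcup => // [|[A s] [/= FA sF VA]].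
  apply: card_le_trans (card_setX_infinite Finf).
  apply: card_le_trans (card_le_setX (card_lexx F) (card_le_seqs Finf)).
  by apply: subset_card_le => -[A s] [].
apply: finite_card_le => //; apply: compact_finite_discrete.
  apply: subclosed_compact cX _ => //; apply: closedI; first exact: closed_closure.
  exact: closed_common_limit_points.
by move=> x [Vx sx] Ax; apply: (VA x Vx).
Qed.

(** Diagonalization of length omega against all traps: at each step the trap of
the current open set is dealt with as a whole, so countably many steps suffice
whatever the cardinality of [F]. *)
Lemma exists_dense_trap (X : topologicalType) (F : set (set X)) :
  [set: X] !=set0 -> compact [set: X] -> hausdorff_space X -> discrete_cover F ->
  exists V : set X, [/\ open V, V !=set0 & V `<=` closure (trap F V)].
Proof.
move=> [x0 _] cX hX Fcov; apply: contrapT => nV.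
pose nonempty_open (V : set X) := open V /\ V !=set0.
pose O := {V | nonempty_open V}.
(* If no trap is dense, regularity leaves room for the next open set. *)
have /choice[next nextP] : forall V : O, exists V' : O,
    closure (sval V') `<=` sval V `\` trap F (sval V).
  move=> [V [oV V0]] /=; have [x [Vx nx]] : exists x, V x /\ ~ closure (trap F V) x.
    apply: contrapT => nx; apply: nV; exists V; split=> // x Vx.
    by apply: contrapT => cx; apply: nx; exists x.
  have /(compact_regular hX cX filterT)[W Wx WV] :
      nbhs x (V `\` closure (trap F V)).
    apply: open_nbhs_nbhs; split=> //; apply: openI => //.
    exact/closed_openC/closed_closure.
  have W'P : nonempty_open W° by split; [exact: open_interior|exists x].
  exists (exist _ _ W'P) => /= y /(closureS (@interior_subset _ W))/WV[Vy ny].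
  by split=> // ty; apply: ny; exact: subset_closure.
have TP : nonempty_open [set: X] by split; [exact: openT|exists x0].
pose V n : O := iter n next (exist _ _ TP).
pose C n := closure (sval (V n)).
have clC n : closed (C n) by exact: closed_closure.
have CV n : C n.+1 `<=` sval (V n) `\` trap F (sval (V n)) by exact: nextP.
have Cdec n : C n.+1 `<=` C n by move=> x /CV[/subset_closure].
have K0 : \bigcap_n C n !=set0.
  apply: contrapT => /set0P/negP/negPn/eqP K0.
  have [|n] := compact_nested_sub cX clC Cdec (@open0 X); first by rewrite K0.
  by case: (svalP (V n)) => _ [x /subset_closure Cx] /(_ x Cx).
have clK : closed (\bigcap_n C n) by apply: closed_bigI.
have [A [s [FA sF KA [x [Kx sx Ax]]]]] := compact_has_pattern cX hX Fcov clK K0.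
(* The pattern of the limit set already fits some [C n]. *)
have [|n CA] := compact_nested_sub cX clC Cdec _ KA.
  apply: closed_openC; apply: closedI; first exact: closed_common_limit_points.
  exact/limit_point_closed/hausdorff_accessible.
have [_] := CV n x (Kx n.+1 I); apply; exists (A, s) => //.
by split=> //; split=> //; exact: Kx.
Qed.

(** * Discrete sets are no larger than dense sets *)

(** [P] meets the members of a disjoint open expansion of [D] in distinct
points. *)
Lemma card_discrete_le_dense (X : topologicalType) (V P D : set X) :
  hausdorff_space X -> hereditarily_collectionwise_hausdorff X ->
  open V -> V `<=` closure P -> D `<=` V -> discrete_set D -> D #<= P.
Proof.
move=> hX hcwh oV VP DV dD; have [W [WD Wtriv]] := discrete_expansion hX hcwh dD.
have /choice[p pP] : forall d, exists p, D d -> P p /\ W d p.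
  move=> d; have [Dd|nDd] := pselect (D d); last by exists d.
  have [oW Wd] := WD d Dd.
  have [q [Pq [Wq _]]] : P `&` (W d `&` V) !=set0.
    apply: (VP d (DV d Dd)); apply: open_nbhs_nbhs.
    by split; [exact: openI|split=> //; exact: DV].
  by exists q.
have pinj : {in D &, injective p}.
  move=> d e /set_mem Dd /set_mem De pde; apply: Wtriv => //.
  by exists (p d); split; [case: (pP d Dd)|rewrite pde; case: (pP e De)].
have := inj_card_eq pinj; rewrite card_eq_le => /andP[_ /card_le_trans]; apply.
by apply: subset_card_le => _ [d Dd <-]; case: (pP d Dd).
Qed.

Theorem theorem2p5 (X : topologicalType) (X_nonempty : [set: X] !=set0)
    (X_compact : compact [set: X]) (X_hausdorff : hausdorff_space X)
    (X_hcwH : hereditarily_collectionwise_hausdorff X) :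
  Delta X #<= dis X.
Proof.
have [Fcov _] := disP X; have [Fd FT] := Fcov; set F := dis X in Fcov Fd FT *.
have [_ DeltaX] := DeltaP X_nonempty.
suff [V [oV V0 VF]] : exists V : set X, [/\ open V, V !=set0 & V #<= F].
  exact: card_le_trans (DeltaX V oV V0) VF.
have [Ffin|Finf] := pselect (finite_set F).
  have [s Fs] := (finite_seqP F).1 Ffin.
  have [||||x ox] := @finite_discrete_cover_isolated X s [set: X] X_hausdorff.
  - by move=> A As; apply: Fd; rewrite Fs.
  - exact: openT.
  - exact: X_nonempty.
  - by rewrite -Fs FT.
  exists [set x]; split=> //; first by exists x.
  have [A FA _] : (\bigcup_(A in F) A) x by rewrite FT.
  apply: card_le_trans (card_image_le (fun=> x) F) => //.
  by apply: subset_card_le => _ ->; exists A.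
have [V [oV V0 Vtrap]] := exists_dense_trap X_nonempty X_compact X_hausdorff Fcov.
exists V; split=> //; rewrite -[V]setTI -FT setI_bigcupl.
apply: card_le_bigcup => // A FA.
apply: card_le_trans (card_trap_le V X_compact X_hausdorff Finf).
apply: (card_discrete_le_dense X_hausdorff X_hcwH oV Vtrap); first exact: subIsetr.
by apply: discrete_setS (Fd A FA); exact: subIsetl.
Qed.
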